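(* Every invertible generalized hyperbolic operator on a Banach space (over $\mathbb{R}$ or $\mathbb{C}$) is topologically stable.
   Context: $\mathbb{N}_0=\{0,1,2,\dots\}$. Let $X$ be a Banach space and $T$ an invertible continuous linear operator on $X$ (with continuous inverse). $T$ is generalized hyperbolic if there is a topological direct sum decomposition $X=M\oplus N$ (algebraic direct sum with $(y,z)\mapsto y+z$ a homeomorphism $M\times N\to X$) such that $T(M)\subset M$, $T^{-1}(N)\subset N$, and there exist $c>0$, $t\in(0,1)$ with $\|T^ny\|\le c\,t^n\|y\|$ and $\|T^{-n}z\|\le c\,t^n\|z\|$ for all $y\in M$, $z\in N$, $n\in\mathbb{N}_0$. $T$ is topologically stable if for every neighborhood $V$ of $0$ in $X$ there is a neighborhood $U$ of $0$ in $X$ such that for every (not necessarily linear) homeomorphism $S:X\to X$ with $Tx-Sx\in U$ for all $x\in X$, there is a continuous map $\phi:X\to X$ with $T\circ\phi=\phi\circ S$ and $\phi(x)-x\in V$ for all $x\in X$. *)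

(* Defs.v *)
From HB Require Import structures.
From mathcomp Require Import all_boot all_order all_algebra.
From mathcomp Require Import all_classical all_reals all_analysis.
From mathcomp Require Export complex.

Set Implicit Arguments.
Unset Strict Implicit.
Unset Printing Implicit Defensive.

Import Order.TTheory GRing.Theory Num.Theory.
Import numFieldNormedType.Exports.

Local Open Scope classical_set_scope.
Local Open Scope ring_scope.

Definition inverse_homeomorphisms (A B : topologicalType)
    (f : A -> B) (g : B -> A) : Prop :=
  [/\ continuous f, continuous g, cancel f g & cancel g f].

Definition homeomorphism (A B : topologicalType) (f : A -> B) : Prop :=
  exists g : B -> A, inverse_homeomorphisms f g.

Section NormedSpace.
Variables (K : numFieldType) (X : normedModType K).

Definition linear_subspace (M : set X) : Prop :=
  M 0 /\ forall (a : K) (x y : X), M x -> M y -> M (a *: x + y).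

(* [set_type M] carries the topology induced by [X], and the domain of the sum
   map the product topology. *)
Definition topological_direct_sum (M N : set X) : Prop :=
  [/\ linear_subspace M,
      linear_subspace N,
      M `&` N = [set 0],
      forall x : X, exists2 y : X, M y & exists2 z : X, N z & x = y + z &
      homeomorphism
        (fun yz : (set_type M * set_type N)%type =>
           (set_val yz.1 : X) + (set_val yz.2 : X))].

(* The norm of [X] takes its values in [K]; when [K] is the field of complex
   numbers, [0 < c] and [0 < t < 1] force [c] and [t] to be real, so that the
   estimates below are inequalities between real numbers. *)
Definition generalized_hyperbolic (T Tinv : X -> X) : Prop :=
  exists M N : set X,
    [/\ topological_direct_sum M N,
        T @` M `<=` M,
        Tinv @` N `<=` N &
        exists c t : K,
          [/\ 0 < c, 0 < t, t < 1,
              forall (y : X) (n : nat),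
                M y -> `|iter n T y| <= c * t ^+ n * `|y| &
              forall (z : X) (n : nat),
                N z -> `|iter n Tinv z| <= c * t ^+ n * `|z| ]].

Definition topologically_stable (T : X -> X) : Prop :=
  forall V : set X, nbhs (0 : X) V ->
  exists2 U : set X, nbhs (0 : X) U &
    forall S : X -> X, homeomorphism S -> (forall x : X, U (T x - S x)) ->
    exists phi : X -> X,
      [/\ continuous phi,
          T \o phi = phi \o S &
          forall x : X, V (phi x - x)].

End NormedSpace.

(* Main.v *)
Require Import Defs.
From HB Require Import structures.
From mathcomp Require Import all_boot all_order all_algebra ring.
From mathcomp Require Import all_classical all_reals all_analysis.

Set Implicit Arguments.
Unset Strict Implicit.
Unset Printing Implicit Defensive.

Import Order.TTheory GRing.Theory Num.Theory.
Import numFieldNormedType.Exports.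

Local Open Scope classical_set_scope.
Local Open Scope ring_scope.

(** Write [X = M + N] with continuous projections [P] and [Q], let [S] be a
    homeomorphism close to [T], and put [h y = T (S^-1 y) - y], which is
    uniformly small. A map [phi = id + alpha] satisfies [T o phi = phi o S] iff
    [alpha x = T (alpha (S^-1 x)) + h x], and this equation is solved by
      [alpha x = \sum_(k >= 0) T^k P h (S^-k x)
                 - \sum_(k >= 1) T^-k Q h (S^k x)].
    The contraction estimates make both series converge uniformly, at a
    geometric rate, to a small continuous function. *)

(** A general [numFieldType] need not be Archimedean, so geometric decay is isolated as a hypothesis
    on the scalars. This lets one argument serve both the real and the complex case. *)
Definition powers_vanish (K : numFieldType) : Prop :=
  forall t e : K, 0 < t -> t < 1 -> 0 < e -> \forall n \near \oo, t ^+ n < e.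

Lemma powers_vanish_real (R : realType) : powers_vanish R.
Proof.
move=> t e t0 t1 e0.
have : `|t| < 1 by rewrite gtr0_norm.
move=> /cvg_expr /cvgrPdist_lt /(_ e e0); apply: filterS => n /=.
by rewrite sub0r normrN gtr0_norm ?exprn_gt0.
Qed.

(** In the order on complex numbers, positivity forces [t] and [e] to be real, which reduces the
    claim to the real case. *)
Lemma powers_vanish_complex (R : realType) : powers_vanish (complex R).
Proof.
move=> t e t0 t1 e0.
have tE : t = (complex.Re t)%:C%C by rewrite RRe_real ?gtr0_real.
have eE : e = (complex.Re e)%:C%C by rewrite RRe_real ?gtr0_real.
move: t0 t1 e0; rewrite {}tE {}eE; set u := complex.Re t; set d := complex.Re e.
rewrite !ltcR => u0 u1 d0.
have := powers_vanish_real u0 u1 d0.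
by apply: filterS => n ud; rewrite -rmorphXn ltcR.
Qed.

Section GeometricSeries.
Variables (K : numFieldType) (geo : powers_vanish K).
Variables (X : completeNormedModType K) (t : K).
Hypotheses (t0 : 0 < t) (t1 : t < 1).

Lemma near_mul_powers_lt (B e : K) : 0 <= B -> 0 < e ->
  \forall n \near \oo, B * t ^+ n < e.
Proof.
move=> B0 e0; have B1 : 0 < B + 1 by rewrite ltr_wpDl.
have := geo t0 t1 (divr_gt0 e0 B1).
apply: filterS => n; rewrite ltr_pdivlMr // mulrC; apply: le_lt_trans.
by rewrite ler_wpM2r ?exprn_ge0 ?ltW // ltrDl.
Qed.

Lemma geometric_tail_le (n m : nat) : (n <= m)%N ->
  \sum_(n <= k < m) t ^+ k <= t ^+ n / (1 - t).
Proof.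
move=> nm; have t1' : 0 < 1 - t by rewrite subr_gt0.
rewrite ler_pdivlMr // mulr_suml.
(* Multiplied by [1 - t], the sum telescopes to [t ^+ n - t ^+ m]. *)
under eq_bigr do rewrite mulrBr mulr1 -exprSr -opprB.
by rewrite sumrN telescope_sumr // opprB gerBl exprn_ge0 ?ltW.
Qed.

Lemma series_tail_le (B : K) (a : X^nat) (n m : nat) : 0 <= B ->
  (forall k, `|a k| <= B * t ^+ k) -> (n <= m)%N ->
  `|series a m - series a n| <= B / (1 - t) * t ^+ n.
Proof.
move=> B0 aB nm; rewrite sub_series_geq //.
apply: (le_trans (ler_norm_sum _ _ _)).
apply: (@le_trans _ _ (\sum_(n <= k < m) B * t ^+ k)); first exact: ler_sum.
by rewrite -mulr_sumr -mulrA ler_wpM2l // mulrC geometric_tail_le.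
Qed.

Lemma geometric_series_cvg (B : K) (a : X^nat) : 0 <= B ->
  (forall k, `|a k| <= B * t ^+ k) ->
  exists2 l : X, series a @ \oo --> l &
    forall n, `|l - series a n| <= B / (1 - t) * t ^+ n.
Proof.
move=> B0 aB.
have D0 : 0 <= B / (1 - t) by rewrite divr_ge0 // subr_ge0 ltW.
have /cvg_ex[l al] : cvg (series a @ \oo).
  apply: cauchy_cvg; apply: cauchy_exP => e e0.
  have [n _ nP] := near_mul_powers_lt D0 e0.
  exists (series a n), n => // m /= nm.
  rewrite -ball_normE /= distrC.
  exact: le_lt_trans (series_tail_le B0 aB nm) (nP n (leqnn n)).
(* The tail bound passes to the limit up to [e]: compare [l] with a partial sum whose index is
   beyond both [n] and the threshold for [e]. *)
exists l => // n; apply/ler_addgt0Pr => e e0.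
have [k _ kP] := cvgr_dist_lt _ _ al _ e0.
rewrite -(subrKA (series a (maxn k n))) addrC.
apply: (le_trans (ler_normD _ _)); apply: lerD.
  exact: series_tail_le (leq_maxr _ _).
by rewrite ltW // kP //= leq_maxl.
Qed.

(** Weierstrass test: the tail bound is uniform in [x], so an [e / 3] argument carries continuity
    from the partial sums to the limit. The tail from index 0 bounds [F]. *)
Lemma geometric_series_continuous (Y : topologicalType) (B : K)
    (f : nat -> Y -> X) : 0 <= B ->
  (forall k, continuous (f k)) -> (forall k x, `|f k x| <= B * t ^+ k) ->
  exists F : Y -> X,
    [/\ continuous F,
        forall x, series (f ^~ x) @ \oo --> F x &
        forall x, `|F x| <= B / (1 - t)].
Proof.
move=> B0 fc fB.
have D0 : 0 <= B / (1 - t) by rewrite divr_ge0 // subr_ge0 ltW.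
have /choice[F FP] x : exists l : X, series (f ^~ x) @ \oo --> l /\
    forall n, `|l - series (f ^~ x) n| <= B / (1 - t) * t ^+ n.
  by have [l ? ?] := geometric_series_cvg B0 (fB ^~ x); exists l.
exists F; split=> [x|x|x]; last 2 first.
- by have [] := FP x.
- by have [_ /(_ 0%N)] := FP x; rewrite /series /= big_nil subr0 mulr1.
apply/cvgrPdist_lt => e e0.
have e30 : 0 < e / 3 by rewrite divr_gt0.
have [n _ /(_ n (leqnn n)) /= nP] := near_mul_powers_lt D0 e30.
have sc : series (f ^~ y) n @[y --> x] --> series (f ^~ x) n.
  elim: n {nP} => [|n IH].
    rewrite (_ : (fun y => _) = cst 0) ?[series _ _]big_nil;
      first exact: cvg_cst.
    by apply/funext => y; rewrite /series /= big_nil.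
  rewrite seriesSr (_ : (fun y => _) = fun y => series (f ^~ y) n + f n y).
    exact: (cvgD IH (fc n x)).
  by apply/funext => y; rewrite seriesSr.
move/cvgrPdist_lt : sc => /(_ _ e30); apply: filterS => y /= xy.
have -> : F x - F y = (F x - series (f ^~ x) n)
    + (series (f ^~ x) n - series (f ^~ y) n) + (series (f ^~ y) n - F y).
  by rewrite !subrKA.
have -> : e = e / 3 + e / 3 + e / 3 by field.
apply: (le_lt_trans (ler_normD _ _)); apply: ltrD; last first.
  by rewrite distrC; apply: le_lt_trans nP; have [] := FP y.
apply: (le_lt_trans (ler_normD _ _)); apply: ltrD => //.
by apply: le_lt_trans nP; have [] := FP x.
Qed.

End GeometricSeries.

Lemma iter_continuous (Y : topologicalType) (f : Y -> Y) (n : nat) :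
  continuous f -> continuous (iter n f).
Proof.
move=> fc; elim: n => [|n IH] x; first exact: cvg_id.
exact: (continuous_comp (IH x) (fc _)).
Qed.

(** The projections are the coordinates of the inverse of the sum map; being a homeomorphism, that
    map makes them continuous. *)
Lemma direct_sum_projections (K : numFieldType) (X : normedModType K)
    (M N : set X) : topological_direct_sum M N ->
  exists P Q : X -> X,
    [/\ continuous P, continuous Q, P 0 = 0 /\ Q 0 = 0,
        forall x, M (P x) /\ N (Q x) & forall x, P x + Q x = x].
Proof.
move=> [[M0 _] [N0 _] _ _ [g [_ gc gK Kg]]].
exists (fun x => set_val (g x).1), (fun x => set_val (g x).2).
have vc (A : set X) : continuous (set_val : A -> X)
  := @initial_continuous A X _.
split=> [x|x||x|x].
- apply: (@continuous_comp _ _ _ (fun x => (g x).1) set_val); last exact: vc.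
  by apply: (@continuous_comp _ _ _ g fst); [exact: gc|exact: cvg_fst].
- apply: (@continuous_comp _ _ _ (fun x => (g x).2) set_val); last exact: vc.
  by apply: (@continuous_comp _ _ _ g snd); [exact: gc|exact: cvg_snd].
- have := gK (exist _ 0 (mem_set M0), exist _ 0 (mem_set N0)).
  by rewrite /= !set_valE /= addr0 => ->.
- by split; apply: set_valP.
- exact: Kg.
Qed.

Lemma generalized_hyperbolic_topologically_stable (K : numFieldType)
    (X : completeNormedModType K) (T : {linear X -> X}) (Tinv : X -> X) :
  powers_vanish K -> inverse_homeomorphisms T Tinv ->
  generalized_hyperbolic T Tinv -> topologically_stable T.
Proof.
move=> geo [Tc Tic TK KT] [M [N [/direct_sum_projections]]].
move=> [P [Q [Pc Qc [P0 Q0] PQM PQ]]] _ _ [c [t [c0 t0 t1 MT NT]]] V.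
have t1' : 0 < 1 - t by rewrite subr_gt0.
move=> /nbhs_norm0P[e /= e0 eV].
have [d d0 de] : exists2 d : K, 0 < d & 2 * c * d / (1 - t) < e.
  (* The correction [alpha] will be bounded by [2 * c * d / (1 - t)]; this [d] makes that bound
     equal to [e / 2]. *)
  exists (e * (1 - t) / (4 * c)); first by rewrite divr_gt0 ?mulr_gt0.
  rewrite (_ : _ / _ = e / 2); last by field; rewrite !gt_eqF.
  by rewrite gtr_pMr // invf_lt1 // ltr1n.
have small (p : X -> X) : continuous p -> p 0 = 0 ->
    \forall x \near (0 : X), `|p x| < d.
  move=> pc p0; have /cvgrPdist_lt /(_ _ d0) := pc 0.
  by apply: filterS => x; rewrite p0 sub0r normrN.
exists [set x | `|P x| < d /\ `|Q x| < d].
  by apply: filterI; exact: small.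
move=> S [Si [Sc Sic SK KS]] TS.
pose h y := T (Si y) - y.
have hS x : h (S x) = T x - S x by rewrite /h SK.
(* Surjectivity of [S] turns the closeness of [T] and [S] into a bound on [h] at every point. *)
have hd x : `|P (h x)| < d /\ `|Q (h x)| < d.
  by rewrite -(KS x) hS; exact: TS.
have hc : continuous h.
  move=> x; apply: cvgB; last exact: cvg_id.
  by apply: continuous_comp; [exact: Sic|exact: Tc].
(* Term [k] of the forward series is paired with term [k.+1] of the backward one, so that a single
   series indexed from 0 covers both. *)
pose f k x := iter k T (P (h (iter k Si x)))
              - iter k.+1 Tinv (Q (h (iter k.+1 S x))).
pose B := 2 * c * d.
have B0 : 0 <= B by rewrite /B !mulr_ge0 ?(ltW c0) ?(ltW d0).
have Bp k x : `|iter k T (P (h x))| <= c * d * t ^+ k.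
  apply: (le_trans (MT _ _ (PQM _).1)).
  rewrite mulrAC ler_wpM2r ?exprn_ge0 ?(ltW t0) // ler_wpM2l ?(ltW c0) //.
  by rewrite ltW //; have [] := hd x.
have Bq k x : `|iter k Tinv (Q (h x))| <= c * d * t ^+ k.
  apply: (le_trans (NT _ _ (PQM _).2)).
  rewrite mulrAC ler_wpM2r ?exprn_ge0 ?(ltW t0) // ler_wpM2l ?(ltW c0) //.
  by rewrite ltW //; have [] := hd x.
have fB k x : `|f k x| <= B * t ^+ k.
  apply: (le_trans (ler_normB _ _)).
  rewrite /B -mulrA -mulrA mulr_natl mulr2n mulrA; apply: lerD => //.
  (* The backward term carries one more factor [t], which is at most 1 and is dropped. *)
  apply: (le_trans (Bq _ _)); rewrite exprS mulrCA ler_piMl ?(ltW t1) //.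
  by rewrite !mulr_ge0 ?exprn_ge0 ?(ltW c0) ?(ltW d0) ?(ltW t0).
have fc k : continuous (f k).
  move=> x; apply: cvgB.
    apply: continuous_comp; last exact: iter_continuous.
    apply: continuous_comp; last exact: Pc.
    by apply: continuous_comp; [exact: iter_continuous|exact: hc].
  apply: (@continuous_comp _ _ _ _ (iter k.+1 Tinv));
    last exact: iter_continuous.
  apply: (@continuous_comp _ _ _ _ Q); last exact: Qc.
  apply: (@continuous_comp _ _ _ (iter k.+1 S) h); last exact: hc.
  exact: iter_continuous.
have [alpha [ac fa ab]] := geometric_series_continuous geo t0 t1 B0 fc fB.
(* The partial sums satisfy the equation for [alpha] up to the two boundary
   terms produced by shifting the index. *)
have partial x n : T (series (f ^~ (Si x)) n) + h x = series (f ^~ x) n +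
    (iter n T (P (h (iter n Si x))) + iter n Tinv (Q (h (iter n S x)))).
  have Tf k : T (f k (Si x)) = iter k.+1 T (P (h (iter k.+1 Si x)))
      - iter k Tinv (Q (h (iter k S x))).
    by rewrite /f linearB (iterSr k S) KS (iterSr k Si) (iterS k Tinv) KT.
  elim: n => [|n IH].
    (* At [n = 0] the boundary terms are the two components of [h x], which add up to [h x]. *)
    by rewrite /series /= !big_nil linear0 !add0r PQ.
  rewrite !seriesSr linearD addrAC IH Tf [f n x]/f -!addrA; do 2 congr (_ + _).
  by rewrite addrCA subrr [RHS]addrCA addNr.
have aE x : T (alpha (Si x)) + h x = alpha x.
  have lhs : T (series (f ^~ (Si x)) n) + h x @[n --> \oo] -->
      T (alpha (Si x)) + h x.
    apply: cvgD; last exact: cvg_cst.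
    exact: continuous_cvg (Tc _) (fa _).
  suff rhs : T (series (f ^~ (Si x)) n) + h x @[n --> \oo] --> alpha x.
    exact: (cvg_unique (@norm_hausdorff _ X) lhs rhs).
  under eq_fun do rewrite partial.
  rewrite -[alpha x]addr0; apply: cvgD; first exact: fa.
  (* Both boundary terms are at most [c * d * t ^+ n], so they vanish in the limit. *)
  apply/cvgrPdist_lt => u u0.
  have := near_mul_powers_lt geo t0 t1 B0 u0.
  apply: filterS => n; rewrite sub0r normrN; apply: le_lt_trans.
  apply: (le_trans (ler_normD _ _)).
  by rewrite /B -mulrA -mulrA mulr_natl mulr2n mulrA; apply: lerD.
exists (fun x => x + alpha x); split=> [x||x].
- by apply: cvgD; [exact: cvg_id|exact: ac].
(* The equation for [alpha] at [S x] reads [alpha (S x) = T (alpha x) + T x - S x], which is the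
   conjugacy relation. *)
- apply/funext => x /=; rewrite linearD /= -(aE (S x)) SK hS.
  by rewrite [RHS]addrC addrA subrK addrC.
- by apply: eV => /=; rewrite addrAC subrr add0r (le_lt_trans (ab x)) //.
Qed.

Theorem corollary27 (R : realType) :
  (forall (X : completeNormedModType R) (T : {linear X -> X}) (Tinv : X -> X),
     inverse_homeomorphisms T Tinv ->
     generalized_hyperbolic T Tinv ->
     topologically_stable T) /\
  (forall (X : completeNormedModType (complex R))
          (T : {linear X -> X}) (Tinv : X -> X),
     inverse_homeomorphisms T Tinv ->
     generalized_hyperbolic T Tinv ->
     topologically_stable T).
Proof.
split=> X T Tinv; apply: generalized_hyperbolic_topologically_stable.
- exact: powers_vanish_real.
- exact: powers_vanish_complex.
Qed.
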